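(* For any constant $\epsilon>0$, there is an efficiently samplable distribution on $n$-vertex Min-Bisection instances such that, with high probability over the choice of instance: (i) there is a degree-$\Omega(\sqrt n)$ SOS solution with objective value $\frac34-\epsilon$, in which the bisection identity is satisfied exactly with pseudovariance zero; and (ii) every genuine bisection has objective value at least $1-\epsilon$. In particular, degree-$o(\sqrt n)$ SOS does not deliver a factor-$(\frac43-\epsilon)$ approximation for Min-Bisection.
   Context: Min-Bisection: given a graph on $n$ vertices ($n$ even), find a partition of the vertices into two halves of size $n/2$ minimizing the number of cut edges; objective values are the number of cut edges divided by a fixed normalization depending only on the instance. SOS formulation: a $\pm1$-valued indeterminate $u_v$ per vertex, the bisection identity $\sum_v u_v=0$, and objective $\frac14\sum_{\{a,b\}\in E}(u_a-u_b)^2$. A degree-$d$ SOS solution is a degree-$d$ pseudoexpectation $\widetilde{\mathbb{E}}$ (linear functional on polynomials of degree $\le d$, respecting $u_v^2=1$, $\widetilde{\mathbb{E}}[1]=1$, $\widetilde{\mathbb{E}}[Q^2]\ge0$ for $\deg Q\le d/2$); its objective value is $\widetilde{\mathbb{E}}$ of the objective; an identity $Q=b$ holds with pseudovariance zero if $\widetilde{\mathbb{E}}[Q]=b$ and $\widetilde{\mathbb{E}}[Q^2]=b^2$.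
   Formalization: The constant ε is restricted to 0 < ε ≤ 3/4, because for ε > 3/4 the SOS objective value 3/4 − ε would be negative, which is impossible for a sum of squares divided by a positive normalization. *)

(* Defs.v *)
(* The notations of mpoly clash with those of MathComp-Analysis. *)
From HB Require Import structures.
From mathcomp Require Import all_boot all_order all_algebra.
From mathcomp Require Import boolp classical_sets reals ereal topology.
From mathcomp Require Import normedtype sequences.
From mathcomp Require Import -(notations) mpoly.

Set Implicit Arguments.
Unset Strict Implicit.
Unset Printing Implicit Defensive.

Import Order.TTheory GRing.Theory Num.Theory.
Import numFieldNormedType.Exports.

Local Open Scope ring_scope.

Section Graphs.
Variable n : nat.

(* Simple graphs on the vertex set {0, ..., n-1}, as symmetric irreflexive
   adjacency functions. *)
Definition is_graph (e : {ffun 'I_n -> {ffun 'I_n -> bool}}) : bool :=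
  [forall a, ~~ e a a] && [forall a, forall b, e a b == e b a].

Definition graph := {e : {ffun 'I_n -> {ffun 'I_n -> bool}} | is_graph e}.

Definition adj (G : graph) (a b : 'I_n) : bool := val G a b.

(* Each edge {a, b} is represented once, by the pair with a < b. *)
Definition edges (G : graph) : {set 'I_n * 'I_n} :=
  [set p : 'I_n * 'I_n | (p.1 < p.2)%N && adj G p.1 p.2].

(* One half S of the partition determines the other, ~: S. *)
Definition bisection (S : {set 'I_n}) : bool := (#|S|.*2 == n).

Definition cut_size (G : graph) (S : {set 'I_n}) : nat :=
  #|[set p in edges G | (p.1 \in S) != (p.2 \in S)]|.

(* The neutral element #|edges G| is an upper bound of all cut sizes, hence
   harmless as soon as n is even. *)
Definition min_bisection (G : graph) : nat :=
  \big[minn/#|edges G|]_(S : {set 'I_n} | bisection S) cut_size G S.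

End Graphs.

Section SumOfSquares.
Variables (R : realType) (n : nat).

Local Notation poly := (mpoly n R).

Definition u (v : 'I_n) : poly := mpolyX R (mnm1 v).

(* mmeasure mdeg p, i.e. msize p, is 1 + the total degree of p, and 0 for
   p = 0. *)
Definition deg_le (d : nat) (p : poly) : bool := (mmeasure mdeg p <= d.+1)%N.

(* Only the values of E on polynomials of degree at most d are meaningful. *)
Record pseudoexpectation (d : nat) (E : poly -> R) : Prop := {
  pE_linear : forall (a : R) (p q : poly), deg_le d p -> deg_le d q ->
    E (a *: p + q) = a * E p + E q;
  pE_one : E 1 = 1;
  pE_pm1 : forall (v : 'I_n) (p : poly), deg_le d ((u v ^+ 2 - 1) * p) ->
    E ((u v ^+ 2 - 1) * p) = 0;
  pE_square : forall Q : poly, deg_le d./2 Q -> 0 <= E (Q ^+ 2)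
}.

Definition pseudovariance_zero (E : poly -> R) (Q : poly) (b : R) : Prop :=
  E Q = b /\ E (Q ^+ 2) = b ^+ 2.

Definition bisection_poly : poly := \sum_(v < n) u v.

Definition cut_poly (G : graph n) : poly :=
  4^-1 *: \sum_(p in edges G) (u p.1 - u p.2) ^+ 2.

Definition sos_solution (d : nat) (E : poly -> R) : Prop :=
  pseudoexpectation d E /\ pseudovariance_zero E bisection_poly 0.

Definition sos_opt (d : nat) (G : graph n) : \bar R :=
  ereal_inf [set (E (cut_poly G))%:E | E in sos_solution d]%classic.

(* A factor-alpha approximation of a minimum: the relaxation value (which is
   at most the optimum) is within a factor alpha of it, on every instance. *)
Definition sos_approximates (d : nat) (alpha : R) : Prop :=
  forall G : graph n,
    ((min_bisection G)%:R%:E <= alpha%:E * sos_opt d G)%E.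

End SumOfSquares.

(* Random access machines in the style of Cook and Reckhow, with unbounded
   registers indexed by nat, indirect addressing and a coin-tossing
   instruction. There is no multiplication, so that unit-cost polynomial time
   on this model is polynomial time on Turing machines. *)
Inductive instr : Type :=
| IConst of nat & nat  (* m[x] := c *)
| IAdd of nat & nat & nat  (* m[x] := m[y] + m[z] *)
| ISub of nat & nat & nat  (* m[x] := m[y] - m[z], truncated *)
| ILoad of nat & nat  (* m[x] := m[m[y]] *)
| IStore of nat & nat  (* m[m[x]] := m[y] *)
| IFlip of nat  (* m[x] := a fresh random bit *)
| IPrint of nat  (* append m[x] to the output *)
| IWhile of nat & seq instr.  (* while m[x] <> 0 do ... *)

Record state := State {
  memory : nat -> nat;
  coins : seq bool;
  output : seq nat
}.

Definition write (s : state) (x k : nat) : state :=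
  State (fun y => if y == x then k else memory s y) (coins s) (output s).

(* The list of instructions is what remains to be executed; the machine has
   halted when it is empty. *)
Definition step (c : seq instr * state) : seq instr * state :=
  let: (p, s) := c in
  let m := memory s in
  match p with
  | [::] => c
  | IConst x k :: p' => (p', write s x k)
  | IAdd x y z :: p' => (p', write s x (m y + m z)%N)
  | ISub x y z :: p' => (p', write s x (m y - m z)%N)
  | ILoad x y :: p' => (p', write s x (m (m y)))
  | IStore x y :: p' => (p', write s (m x) (m y))
  | IFlip x :: p' =>
      (p', write (State m (behead (coins s)) (output s)) x
             (head false (coins s)))
  | IPrint x :: p' => (p', State m (coins s) (rcons (output s) (m x)))
  | IWhile x b :: p' => (if m x == 0%N then p' else b ++ p, s)
  end.

(* The input k is initially in m[0], all other registers being 0. *)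
Definition run (P : seq instr) (k : nat) (r : seq bool) (t : nat) :=
  iter t step (P, State (fun y => if y == 0%N then k else 0%N) r [::]).

(* The program halts within t steps and prints w. *)
Definition prints (P : seq instr) (k : nat) (r : seq bool) (t : nat)
    (w : seq nat) : bool :=
  nilp (run P k r t).1 && (output (run P k r t).2 == w).

(* Row-major adjacency matrix. *)
Definition graph_code (n : nat) (G : graph n) : seq nat :=
  [seq nat_of_bool (adj G a b) | a <- enum 'I_n, b <- enum 'I_n].

Section Distributions.
Variable R : realType.

Definition distribution (T : finType) (mu : T -> R) : Prop :=
  (forall x, 0 <= mu x) /\ \sum_x mu x = 1.

Definition Pr (T : finType) (mu : T -> R) (A : T -> Prop) : R :=
  \sum_(x | `[< A x >]) mu x.

(* Polynomial time is measured in n, i.e. the input n counts as unary. In time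
   t at most t coins are tossed, so that t independent fair coins suffice. *)
Definition efficiently_samplable (D : forall n, graph n -> R) : Prop :=
  exists (P : seq instr) (c : nat), forall n : nat, ~~ odd n ->
    let t := (n ^ c + c)%N in
    (forall r : t.-tuple bool, exists G : graph n,
       prints P n r t (graph_code G)) /\
    (forall G : graph n,
       D n G = #|[set r : t.-tuple bool | prints P n r t (graph_code G)]|%:R
               / 2 ^+ t).

(* Probability tending to 1 as n = 2 k tends to infinity. *)
Definition with_high_probability (D : forall n, graph n -> R)
    (A : forall n, graph n -> Prop) : Prop :=
  (Pr (D k.*2) (A k.*2) @[k --> \oo] --> (1 : R))%classic.

End Distributions.

(* Main.v *)
(* The distribution is concentrated on one graph with optimum at least 1 whose
   degree-Omega(n) SOS value is 0: an odd number m < n / 4 of disjoint edges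
   together with two cliques of n / 2 - m vertices each. A bisection without
   cut edges is constant on the components; it separates the two cliques because
   they are larger than all the edges together, and then it has to split the
   odd number of edges evenly.

   The pseudoexpectation puts the cliques on opposite sides and, for k = m / 2,
   pretends that k of the edges are on the left: it is the signed measure on
   {0,1}^m that extends to non-integral k the uniform distribution on the points
   z with z_1 + ... + z_m = k. For positivity in degree 2 t, reduce a polynomial
   modulo z_1 + ... + z_m = k to the form p = sum_(|S| = t) c_S z_S. Expanding
   the moments of the z_(S U S') over the subsets of S n S' gives
     E p^2 = sum_J w_J (sum_(S >= J) c_S)^2,
   where w_J >= 0 is the probability that |J| given coordinates are 0 and
   2 t - |J| others are 1.

   Mixing this pseudoexpectation with the evaluation at an optimal bisection,
   with weight 3 / 4 - eps on the latter, yields the exact objective value when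
   normalizing by the optimum. *)
Require Import Defs.
From HB Require Import structures.
From mathcomp Require Import all_boot all_order all_algebra.
From mathcomp Require Import boolp reals.
From mathcomp Require Import ring lra zify.
From mathcomp Require Import -(notations) mpoly.

Import Order.TTheory GRing.Theory Num.Theory.
Local Open Scope ring_scope.

(** * Exchangeable signed measure on a slice of the cube *)

Lemma big_subset_setU1 {V : nmodType} {T : finType} (x : T) (I : {set T})
    (F : {set T} -> V) : x \notin I ->
  \sum_(J : {set T} | J \subset x |: I) F J =
  \sum_(J : {set T} | J \subset I) (F J + F (x |: J)).
Proof.
move=> xI; rewrite big_split /= (bigID (fun J : {set T} => x \in J)) /= addrC.
congr (_ + _).
  apply: eq_bigl => J; apply/andP/idP => [[JxI xJ]|JI].
    apply/subsetP => y yJ; have := subsetP JxI y yJ.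
    by rewrite !inE => /predU1P[yx|//]; rewrite -yx yJ in xJ.
  split; first exact: subset_trans JI (subsetUr _ _).
  by apply: contra xI; apply: (subsetP JI).
rewrite (reindex_onto (fun J => x |: J) (fun J => J :\ x)) /=; last first.
  by move=> J /andP[_ xJ]; rewrite setD1K.
apply: eq_bigl => J; apply/idP/idP.
  case/andP=> /andP[JxI _] /eqP eJ; rewrite -eJ.
  apply/subsetP => y; rewrite !inE => /andP[yx /predU1P[yx'|yJ]].
    by rewrite yx' eqxx in yx.
  by have := subsetP JxI y; rewrite !inE yJ orbT (negPf yx) => /(_ isT).
move=> JI; rewrite setUS // setU11 /= setU1K //.
by apply: contra xI; apply: (subsetP JI).
Qed.

Section Slice.
Context {R : realFieldType} {T : finType} (k : R).
Let m := #|T|.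

(** The falling factorial, at a possibly non-integral [x]. *)
Definition ffactr (x : R) (s : nat) : R := \prod_(i < s) (x - i%:R).

(* The probability that s given coordinates are 1 and q others are 0, on the
   slice z_1 + ... + z_m = k. *)
Definition slice_weight (s q : nat) : R :=
  ffactr k s * ffactr (m%:R - k) q / ffactr m%:R (s + q).

(* J is the set of zero coordinates of a point z of the cube. *)
Definition slice_expect (f : {set T} -> R) : R :=
  \sum_(J : {set T}) slice_weight (m - #|J|) #|J| * f J.

(* The product of the z_x over x \in S. *)
Definition avoid (S J : {set T}) : R := (S \subset ~: J)%:R.

Definition degree_le (t : nat) (f : {set T} -> R) : Prop :=
  exists c : {set T} -> R,
    f = fun J => \sum_(S : {set T} | (#|S| <= t)%N) c S * avoid S J.

Lemma ffactrS (x : R) s : ffactr x s.+1 = ffactr x s * (x - s%:R).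
Proof. by rewrite /ffactr big_ord_recr. Qed.

Lemma ffactr_neq0 s : (s <= m)%N -> ffactr m%:R s != 0.
Proof.
move=> sm; rewrite prodf_seq_neq0; apply/allP => i _ /=.
by rewrite subr_eq0 eqr_nat neq_ltn (leq_trans (ltn_ord i) sm) orbT.
Qed.

Lemma ffactr_ge0 (x : R) s : s%:R <= x + 1 -> 0 <= ffactr x s.
Proof.
move=> sx; apply: prodr_ge0 => i _.
have : (i.+1%:R : R) <= s%:R by rewrite ler_nat.
by rewrite -natr1 => ?; lra.
Qed.

(** Condition on one more coordinate: the new factors [k - s] and [m - k - q] add up to the new
    factor [m - (s + q)] of the denominator. *)
Lemma slice_weight_rec s q : (s + q < m)%N ->
  slice_weight s q = slice_weight s.+1 q + slice_weight s q.+1.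
Proof.
move=> sqm; rewrite /slice_weight addSn addnS !ffactrS.
have h1 := ffactr_neq0 _ (ltnW sqm).
have h2 : m%:R - (s + q)%:R != 0 :> R.
  by rewrite subr_eq0 eqr_nat neq_ltn sqm orbT.
by move: h2; rewrite natrD => h2; field; rewrite h1 h2.
Qed.

(** Given [s] ones, the other [m - s] coordinates are exchangeable and contain [k - s] ones in
    total. *)
Lemma slice_weightSl s : (s < m)%N ->
  (m%:R - s%:R) * slice_weight s.+1 0 = (k - s%:R) * slice_weight s 0.
Proof.
move=> sm; rewrite /slice_weight !addn0 !ffactrS /ffactr !big_ord0 -/(ffactr _ _).
have h1 : \prod_(i < s) (m%:R - i%:R) != 0 :> R := ffactr_neq0 _ (ltnW sm).
have h2 : m%:R - s%:R != 0 :> R.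
  by rewrite subr_eq0 eqr_nat neq_ltn sm orbT.
by field; rewrite h1 h2.
Qed.

(** Iterate [slice_weight_rec] over [I]; [J] collects the coordinates of [I] that are 0. *)
Lemma slice_weight_sum (I : {set T}) s q : (s + q + #|I| <= m)%N ->
  slice_weight s q =
  \sum_(J : {set T} | J \subset I) slice_weight (s + #|I| - #|J|) (q + #|J|).
Proof.
have [n] := ubnP #|I|; elim: n => // n IH in I s q *; rewrite ltnS => In sqI.
have [->|[x xI]] := set_0Vmem I.
  rewrite (eq_bigl (pred1 set0)); last by move=> J; rewrite subset0.
  by rewrite big_pred1_eq cards0 !addn0 subn0.
have cI : #|I| = #|I :\ x|.+1 by rewrite (cardsD1 x) xI.
rewrite -{1}(setD1K xI) big_subset_setU1; last by rewrite !inE eqxx.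
rewrite slice_weight_rec; last by lia.
rewrite big_split /= (IH (I :\ x) s.+1 q) ?(IH (I :\ x) s q.+1); try lia.
congr (_ + _); apply: eq_bigr => J JI.
  by congr slice_weight; lia.
have xJ : x \notin J by apply/negP => /(subsetP JI); rewrite !inE eqxx.
by rewrite cardsU1 xJ cI; congr slice_weight; lia.
Qed.

Lemma avoidU S S' J : avoid S J * avoid S' J = avoid (S :|: S') J.
Proof. by rewrite /avoid subUset -natrM mulnb. Qed.

Lemma slice_expect_lin (a : R) f g :
  slice_expect (fun J => a * f J + g J) = a * slice_expect f + slice_expect g.
Proof.
rewrite /slice_expect mulr_sumr -big_split /=; apply: eq_bigr => J _.
by rewrite mulrDr mulrCA.
Qed.

Lemma slice_expect_sum (I : Type) (r : seq I) (P : pred I) (a : I -> R)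
    (f : I -> {set T} -> R) :
  slice_expect (fun J => \sum_(i <- r | P i) a i * f i J) =
  \sum_(i <- r | P i) a i * slice_expect (f i).
Proof.
rewrite /slice_expect (eq_bigr (fun i => \sum_(J : {set T})
   a i * (slice_weight (m - #|J|) #|J| * f i J))).
  rewrite exchange_big /=; apply: eq_bigr => J _.
  by rewrite mulr_sumr; apply: eq_bigr => i _; rewrite mulrCA.
by move=> i _; rewrite mulr_sumr.
Qed.

Lemma slice_expectZ (a : R) f :
  slice_expect (fun J => a * f J) = a * slice_expect f.
Proof.
by rewrite /slice_expect mulr_sumr; apply: eq_bigr => J _; rewrite mulrCA.
Qed.

Lemma eq_slice_expect f g : f =1 g -> slice_expect f = slice_expect g.
Proof. by move=> fg; apply: eq_bigr => J _; rewrite fg. Qed.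

(** Summing out the coordinates outside [S] by [slice_weight_sum] shows that the full measure has
    the prescribed marginals. *)
Lemma slice_expect_avoid S : slice_expect (avoid S) = slice_weight #|S| 0.
Proof.
have cS : (#|S| + #|~: S| = m)%N by rewrite cardsC.
rewrite (slice_weight_sum (~: S) #|S| 0) ?addn0 ?cS //.
rewrite /slice_expect [RHS]big_mkcond; apply: eq_bigr => J _.
rewrite /avoid -[X in _ = if X then _ else _]setCS setCK add0n.
by case: (S \subset ~: J); rewrite ?mulr1 ?mulr0.
Qed.

Lemma degree_le_avoid t (S : {set T}) : (#|S| <= t)%N -> degree_le t (avoid S).
Proof.
move=> St; exists (fun S' => (S' == S)%:R); apply/funext => J.
rewrite (bigD1 S) //= eqxx mul1r big1 ?addr0 // => S' /andP[_ /negPf ->].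
by rewrite mul0r.
Qed.

Lemma degree_le_lin t (a : R) f g : degree_le t f -> degree_le t g ->
  degree_le t (fun J => a * f J + g J).
Proof.
move=> [c ->] [c' ->]; exists (fun S => a * c S + c' S); apply/funext => J.
rewrite mulr_sumr -big_split /=; apply: eq_bigr => S _.
by rewrite mulrDl mulrA.
Qed.

Lemma degree_le_sum t (I : Type) (r : seq I) (P : pred I) (a : I -> R)
    (f : I -> {set T} -> R) : (forall i, P i -> degree_le t (f i)) ->
  degree_le t (fun J => \sum_(i <- r | P i) a i * f i J).
Proof.
move=> df; elim: r => [|i r IH].
  exists (fun=> 0); apply/funext => J; rewrite big_nil big1 // => S _.
  by rewrite mul0r.
have [Pi|Pi] := boolP (P i); last first.
  by rewrite (_ : (fun J => _) = (fun J => \sum_(i <- r | P i) a i * f i J)) //;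
     apply/funext => J; rewrite big_cons (negPf Pi).
rewrite (_ : (fun J => _) =
  (fun J => a i * f i J + \sum_(i <- r | P i) a i * f i J)).
  by apply: degree_le_lin => //; apply: df.
by apply/funext => J; rewrite big_cons Pi.
Qed.

Lemma degree_leM t t' f g : degree_le t f -> degree_le t' g ->
  degree_le (t + t') (fun J => f J * g J).
Proof.
move=> [c ->] [c' ->].
rewrite (_ : (fun J => _) = fun J => \sum_(S : {set T} | (#|S| <= t)%N) c S *
  (\sum_(S' : {set T} | (#|S'| <= t')%N) c' S' * avoid (S :|: S') J)).
  apply: degree_le_sum => S St; apply: degree_le_sum => S' St'.
  by apply: degree_le_avoid; rewrite (leq_trans (leq_card_setU _ _)) // leq_add.
apply/funext => J; rewrite mulr_suml; apply: eq_bigr => S _.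
rewrite -mulrA; congr (_ * _); rewrite mulr_sumr; apply: eq_bigr => S' _.
by rewrite -avoidU mulrCA.
Qed.

Lemma degree_le_cst t (a : R) : degree_le t (fun=> a).
Proof.
rewrite (_ : (fun=> a) = fun J => \sum_(i <- [:: tt]) a * avoid set0 J).
  by apply: degree_le_sum => _ _; apply: degree_le_avoid; rewrite cards0.
by apply/funext => J; rewrite big_seq1 /avoid sub0set mulr1.
Qed.

Lemma degree_leS t t' f : (t <= t')%N -> degree_le t f -> degree_le t' f.
Proof.
move=> tt' [c ->]; apply: degree_le_sum => S St.
by apply: degree_le_avoid; apply: leq_trans tt'.
Qed.

(** [#|~: J|] is the sum of the [z_x]. A coordinate in [S] is absorbed, as [z_x ^ 2 = z_x]; one
    outside enlarges [S]. *)
Lemma card_avoid (S J : {set T}) : #|~: J|%:R * avoid S J =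
  #|S|%:R * avoid S J + \sum_(x | x \notin S) avoid (x |: S) J.
Proof.
rewrite -!sum1_card !natr_sum !mulr_suml [LHS]big_mkcond /=.
rewrite (bigID (mem S)) /=; congr (_ + _); apply: eq_bigr => x xS; last first.
  rewrite mul1r -avoidU /avoid sub1set.
  by case: (x \in ~: J); rewrite ?mul1r ?mul0r.
rewrite mul1r /avoid; case: ifP => // xJ; case: subsetP => // /(_ x xS).
by rewrite xJ.
Qed.

(** On a monomial, [card_avoid] reduces the constraint to the relation [slice_weightSl] between
    consecutive moments. *)
Lemma slice_expect_cardM t g : (t < m)%N -> degree_le t g ->
  slice_expect (fun J => (#|~: J|%:R - k) * g J) = 0.
Proof.
move=> tm [c ->].
rewrite (eq_slice_expect _ (fun J => \sum_(S : {set T} | (#|S| <= t)%N)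
    c S * ((#|S|%:R - k) * avoid S J +
           \sum_(x | x \notin S) 1 * avoid (x |: S) J))); last first.
  move=> J; rewrite mulr_sumr; apply: eq_bigr => S _.
  rewrite mulrCA mulrBl card_avoid -mulr_sumr mul1r; congr (_ * _); ring.
rewrite slice_expect_sum big1 // => S St.
rewrite slice_expect_lin slice_expect_sum slice_expect_avoid.
rewrite (eq_bigr (fun=> slice_weight #|S|.+1 0)); last first.
  by move=> x xS; rewrite mul1r slice_expect_avoid cardsU1 xS.
have -> (a : R) : \sum_(x | x \notin S) a = a *+ (m - #|S|).
  by rewrite sumr_const /m -(cardC (mem S)) addKn.
rewrite -(mulr_natl (slice_weight #|S|.+1 0)) natrB; last first.
  by rewrite ltnW // (leq_ltn_trans St tm).
rewrite slice_weightSl ?(leq_ltn_trans St tm) //.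
by rewrite -mulrDl addrA subrK subrr mul0r mulr0.
Qed.

Definition homogeneous (t : nat) (c : {set T} -> R) (J : {set T}) : R :=
  \sum_(S : {set T} | #|S| == t) c S * avoid S J.

(** Congruence to a homogeneous polynomial modulo the constraint, tested through expectations only,
    so that no ideal has to be introduced. *)
Definition homogenizable (t : nat) (f : {set T} -> R) : Prop :=
  exists c, forall g, degree_le t g ->
    slice_expect (fun J => f J * g J) =
    slice_expect (fun J => homogeneous t c J * g J).

Lemma degree_le_homogeneous t c : degree_le t (homogeneous t c).
Proof.
by apply: degree_le_sum => S /eqP <-; apply: degree_le_avoid.
Qed.

Lemma homogenizable_sum t (I : Type) (r : seq I) (P : pred I) (a : I -> R)
    (f : I -> {set T} -> R) : (forall i, P i -> homogenizable t (f i)) ->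
  homogenizable t (fun J => \sum_(i <- r | P i) a i * f i J).
Proof.
move=> hf; elim: r => [|i r [c IH]].
  exists (fun=> 0) => g _; apply: eq_slice_expect => J; congr (_ * _).
  by rewrite big_nil /homogeneous big1 // => S _; rewrite mul0r.
have [Pi|Pi] := boolP (P i); last first.
  exists c => g dg; rewrite -(IH g dg); apply: eq_slice_expect => J.
  by rewrite big_cons (negPf Pi).
have [c' ci] := hf i Pi; exists (fun S => a i * c' S + c S) => g dg.
rewrite (eq_slice_expect _ (fun J => a i * (f i J * g J) +
    (\sum_(i <- r | P i) a i * f i J) * g J)); last first.
  by move=> J; rewrite big_cons Pi mulrDl mulrA.
rewrite slice_expect_lin (ci g dg) (IH g dg) -slice_expect_lin.
apply: eq_slice_expect => J; rewrite mulrA -mulrDl; congr (_ * _).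
rewrite /homogeneous mulr_sumr -big_split /=; apply: eq_bigr => S _.
by rewrite mulrDl mulrA.
Qed.

(** * Positivity of squares *)

Section Positivity.
Variable t : nat.
Hypotheses (tm : (t.*2 <= m)%N) (tk : t.*2%:R <= k + 1)
  (tmk : t%:R <= m%:R - k + 1).

(* Modulo the constraint, z_S with #|S| < t is a multiple of the sum of the
   z_(x |: S) over x \notin S. *)
Lemma homogenizable_avoid (S : {set T}) : (#|S| <= t)%N ->
  homogenizable t (avoid S).
Proof.
have [n] := ubnP (t - #|S|); elim: n => // n IH in S *; rewrite ltnS => tSn.
rewrite leq_eqVlt => /predU1P[St|St].
  exists (fun S' => (S' == S)%:R) => g _; apply: eq_slice_expect => J.
  rewrite /homogeneous (bigD1 S) ?St //= eqxx mul1r big1 ?addr0 //.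
  by move=> S' /andP[_ /negPf ->]; rewrite mul0r.
(* Here [t >= 1], so [k >= 2 t - 1 >= t > #|S|]. *)
have kS : k - #|S|%:R != 0.
  have : (#|S|.+1%:R : R) <= t%:R by rewrite ler_nat.
  have : (1 : R) <= t%:R by rewrite ler1n (leq_ltn_trans _ St).
  rewrite -natr1; move: tk; rewrite -muln2 natrM => *; lra.
have [] := @homogenizable_sum t T (index_enum T) (fun x => x \notin S)
    (fun=> (k - #|S|%:R)^-1) (fun x => avoid (x |: S)).
  by move=> x xS; apply: IH; rewrite cardsU1 xS ?add1n //; lia.
move=> c hc; exists c => g dg; rewrite -(hc g dg).
(* Up to sign, [k - #|S|] times the difference of the two sides is the expectation of the constraint
   times [avoid S] and [g], a product of degree at most [#|S| + t < m]. *)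
have := @slice_expect_cardM (#|S| + t) (fun J => avoid S J * g J).
rewrite (eq_slice_expect _ (fun J => - (k - #|S|%:R) * (avoid S J * g J) +
   (k - #|S|%:R) * ((\sum_(x | x \notin S)
                       (k - #|S|%:R)^-1 * avoid (x |: S) J) * g J))); last first.
  move=> J; rewrite -mulr_sumr mulrA mulrBl card_avoid.
  by set A := \sum_(x | _) _; field; rewrite kS.
rewrite slice_expect_lin slice_expectZ mulNr addrC => h.
apply: (mulfI kS); apply/eqP; rewrite eq_sym -subr_eq0; apply/eqP; apply: h.
  by lia.
by apply: degree_leM => //; apply: degree_le_avoid.
Qed.

Lemma homogenizable_degree_le f : degree_le t f -> homogenizable t f.
Proof. by move=> [c ->]; apply: homogenizable_sum => S; apply: homogenizable_avoid. Qed.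

(** [slice_weight] sees only cardinalities, so the moment of [S :|: S'] may be split along
    [#|S :&: S'|] fresh coordinates, indexed by [S :&: S']. This makes [2 t] coordinates in all,
    whatever [S] and [S'] are, and the double sum factors into a square for each [J]. *)
Lemma slice_expect_homogeneous_sqr c :
  slice_expect (fun J => homogeneous t c J * homogeneous t c J) =
  \sum_(J : {set T}) slice_weight (t.*2 - #|J|) #|J| *
    (\sum_(S : {set T} | (#|S| == t) && (J \subset S)) c S) ^+ 2.
Proof.
rewrite (eq_slice_expect _ (fun J => \sum_(S : {set T} | #|S| == t)
  c S * \sum_(S' : {set T} | #|S'| == t) c S' * avoid (S :|: S') J)); last first.
  move=> J; rewrite mulr_suml; apply: eq_bigr => S _.
  rewrite -mulrA; congr (_ * _); rewrite mulr_sumr; apply: eq_bigr => S' _.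
  by rewrite mulrCA avoidU.
rewrite slice_expect_sum.
transitivity (\sum_(S : {set T} | #|S| == t) \sum_(S' : {set T} | #|S'| == t)
  \sum_(J : {set T}) c S * (c S' * 
     (slice_weight (t.*2 - #|J|) #|J| * ((J \subset S) && (J \subset S'))%:R))).
  apply: eq_bigr => S /eqP St; rewrite slice_expect_sum mulr_sumr.
  apply: eq_bigr => S' /eqP S't; rewrite -!mulr_sumr slice_expect_avoid.
  congr (_ * (_ * _)).
  have cU := cardsUI S S'.
  rewrite (slice_weight_sum (S :&: S')); last by lia.
  rewrite big_mkcond; apply: eq_bigr => J _; rewrite subsetI add0n cU St S't addnn.
  by case: (_ && _); rewrite ?mulr1 ?mulr0.
under eq_bigr do rewrite exchange_big /=.
rewrite exchange_big /=; apply: eq_bigr => J _.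
rewrite [_ ^+ 2]expr2 big_mkcondr /= mulr_suml mulr_sumr; apply: eq_bigr => S _.
rewrite !mulr_sumr; apply: eq_bigr => S' _.
by case: (J \subset S) (J \subset S') => [] []; rewrite /=; ring.
Qed.

Lemma slice_expect_sqr_ge0 f : degree_le t f ->
  0 <= slice_expect (fun J => f J * f J).
Proof.
move=> df; have [c hc] := homogenizable_degree_le f df.
(* Homogenize one factor at a time, the other one being the test polynomial. *)
rewrite (hc f df) (eq_slice_expect _ (fun J => f J * homogeneous t c J)); last first.
  by move=> J; rewrite mulrC.
rewrite hc; last exact: degree_le_homogeneous.
rewrite slice_expect_homogeneous_sqr; apply: sumr_ge0 => J _.
(* The sign of the weight is controlled for [#|J| <= t]; a larger [J] lies in no [S] of size [t]. *)
have [Jt|tJ] := leqP #|J| t; last first.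
  rewrite big1 ?expr0n ?mulr0 // => S /andP[/eqP St /subset_leq_card].
  by rewrite St leqNgt tJ.
apply: mulr_ge0 (sqr_ge0 _); rewrite /slice_weight subnK; last by lia.
apply: divr_ge0; [apply: mulr_ge0|]; apply: ffactr_ge0.
- by apply: le_trans tk; rewrite ler_nat leq_subr.
- by apply: le_trans tmk; rewrite ler_nat.
- by rewrite natr1 ler_nat leqW.
Qed.

End Positivity.
End Slice.

(** * Pseudoexpectations from slice measures *)

Section PseudoExpectations.
Context {R : realType} {n : nat}.
Implicit Types (E : mpoly n R -> R) (p q : mpoly n R) (d t : nat).

Lemma pseudoexpectation_leq d d' E : (d <= d')%N ->
  pseudoexpectation d' E -> pseudoexpectation d E.
Proof.
move=> dd' [lin one pm1 sqr].
have degS e e' p : (e <= e')%N -> deg_le e p -> deg_le e' p.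
  by move=> ee' /leq_trans; apply.
split=> //.
- by move=> a p q dp dq; apply: lin; apply: degS dd' _.
- by move=> v p dp; apply: pm1; apply: degS dd' _.
- by move=> Q dQ; apply: sqr; apply: degS (half_leq dd') _.
Qed.

Lemma pseudoexpectation_meval d (x : 'I_n -> R) : (forall v, x v ^+ 2 = 1) ->
  pseudoexpectation d (meval x).
Proof.
move=> x1; split=> [a p q _ _||v p _|Q _].
- by rewrite mevalD mevalZ.
- exact: meval1.
- by rewrite mevalM mevalB meval1 expr2 mevalM mevalXU -expr2 x1 subrr mul0r.
- by rewrite expr2 mevalM -expr2 sqr_ge0.
Qed.

Lemma pseudoexpectation_convex d (l : R) E E' : 0 <= l <= 1 ->
  pseudoexpectation d E -> pseudoexpectation d E' ->
  pseudoexpectation d (fun p => (1 - l) * E p + l * E' p).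
Proof.
move=> /andP[l0 l1] [lin one pm1 sqr] [lin' one' pm1' sqr'].
split=> [a p q dp dq||v p dp|Q dQ].
- by rewrite lin // lin' //; ring.
- by rewrite one one'; ring.
- by rewrite pm1 // pm1' // !mulr0 addr0.
- by rewrite addr_ge0 // mulr_ge0 ?subr_ge0 ?sqr ?sqr'.
Qed.

Context {T : finType}.
Variables (k : R) (sigma : 'I_n -> {set T} -> R).

Definition slice_pE p : R := slice_expect k (fun J => meval (sigma^~ J) p).

Hypothesis sigma_sqr : forall v J, sigma v J ^+ 2 = 1.
Hypothesis sigma_deg : forall v, degree_le 1 (sigma v).

Lemma degree_leX t e (f : {set T} -> R) : degree_le t f ->
  degree_le (e * t) (fun J => f J ^+ e).
Proof.
move=> df; elim: e => [|e IH]; first exact: degree_le_cst.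
rewrite (_ : (fun J => _) = fun J => f J * f J ^+ e); first exact: degree_leM.
by apply/funext => J; rewrite exprS.
Qed.

Lemma degree_le_prod (I : Type) (r : seq I) (e : I -> nat)
    (f : I -> {set T} -> R) : (forall i, degree_le (e i) (f i)) ->
  degree_le (\sum_(i <- r) e i) (fun J => \prod_(i <- r) f i J).
Proof.
move=> df; elim: r => [|i r IH].
  rewrite (_ : (fun J => _) = fun=> 1); first exact: degree_le_cst.
  by apply/funext => J; rewrite big_nil.
rewrite big_cons (_ : (fun J => _) = fun J => f i J * \prod_(i <- r) f i J).
  exact: degree_leM.
by apply/funext => J; rewrite big_cons.
Qed.

Lemma degree_le_meval t p : deg_le t p ->
  degree_le t (fun J => meval (sigma^~ J) p).
Proof.
move=> dp.
rewrite (_ : (fun J => _) = fun J => \sum_(m <- msupp p | m \in msupp p)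
    mcoeff m p * \prod_(i < n) sigma i J ^+ m i); last first.
  by apply/funext => J; rewrite mevalE big_seq.
apply: degree_le_sum => m mp; apply: (@degree_leS _ _ (mdeg m)).
  by rewrite -ltnS; apply: leq_trans (mmeasure_mnm_lt _ mp) dp.
rewrite mdegE; apply: degree_le_prod => i.
by rewrite -{1}[m i]muln1; apply: degree_leX.
Qed.

Lemma pseudoexpectation_slice t : (t.*2 <= #|T|)%N -> t.*2%:R <= k + 1 ->
  t%:R <= #|T|%:R - k + 1 -> pseudoexpectation t.*2 slice_pE.
Proof.
move=> tm tk tmk; split=> [a p q _ _||v p _|Q].
- rewrite /slice_pE -slice_expect_lin; apply: eq_slice_expect => J.
  by rewrite mevalD mevalZ.
- rewrite /slice_pE (eq_slice_expect _ _ (avoid set0)).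
    rewrite slice_expect_avoid cards0 /slice_weight /ffactr !big_ord0.
    by rewrite !mul1r invr1.
  by move=> J; rewrite meval1 /avoid sub0set.
- rewrite /slice_pE (eq_slice_expect _ _ (fun J => 0 * 0)).
    by rewrite slice_expectZ mul0r.
  move=> J; rewrite mevalM mevalB meval1 expr2 mevalM mevalXU -expr2.
  by rewrite sigma_sqr subrr mul0r mulr0.
- rewrite doubleK => dQ; rewrite /slice_pE.
  rewrite (eq_slice_expect _ _ (fun J => meval (sigma^~ J) Q * meval (sigma^~ J) Q)).
    by apply: (slice_expect_sqr_ge0 _ t) => //; apply: degree_le_meval.
  by move=> J; rewrite expr2 mevalM.
Qed.

(** The polynomial and its square become multiples of the constraint, with cofactors of degree 0 and
    1, both below [#|T|]. *)
Lemma slice_pE_bisection (a : R) : (1 < #|T|)%N ->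
  (forall J, \sum_v sigma v J = a * (#|~: J|%:R - k)) ->
  pseudovariance_zero slice_pE (bisection_poly R n) 0.
Proof.
move=> m1 hs; rewrite /pseudovariance_zero /slice_pE.
have hJ J : meval (sigma^~ J) (bisection_poly R n) = a * (#|~: J|%:R - k).
  rewrite -hs /bisection_poly raddf_sum; apply: eq_bigr => v _; exact: mevalXU.
rewrite (eq_slice_expect _ _ (fun J => (#|~: J|%:R - k) * a)); last first.
  by move=> J; rewrite hJ mulrC.
rewrite (eq_slice_expect _ (fun J => meval _ (_ ^+ 2))
  (fun J => a * ((#|~: J|%:R - k) * (\sum_v sigma v J)))); last first.
  by move=> J; rewrite expr2 mevalM hJ hs; ring.
rewrite slice_expectZ (slice_expect_cardM _ 0) ?(slice_expect_cardM _ 1) //.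
- by rewrite mulr0 expr0n.
- rewrite (_ : (fun J => _) = fun J => \sum_v 1 * sigma v J).
    by apply: degree_le_sum => v _; apply: sigma_deg.
  by apply/funext => J; apply: eq_bigr => v _; rewrite mul1r.
- exact: ltnW.
- exact: degree_le_cst.
Qed.

End PseudoExpectations.

(** * The gap instance *)

(* An odd number of order n / 4, with 4 * pair_count n < n for n > 4. *)
Definition pair_count (n : nat) : nat := ((n - 12 + 7) %/ 8).*2.+1.

(* With m = pair_count n and v' = n - 1 - v, the vertices v < m and v' are
   labelled v, the remaining ones m in the first half and m + 1 in the second.
   Truncated subtractions replace the case distinctions: x - (x - y) is
   min(x, y), and 1 - (y - x) is the truth value of y <= x. *)
Definition label (n m v : nat) : nat :=
  let w := (v - (v - (n - 1 - v)))%N in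
  ((w - (w - m)) + ((1 - (n - (v + v))) + (1 - (m - w)) - 1))%N.

(** Each label class becomes a clique; the classes of two vertices are the disjoint edges. *)
Definition gap_adj (n i j : nat) : bool :=
  (i != j) && (label n (pair_count n) i == label n (pair_count n) j).

Lemma gap_graph_subproof n :
  is_graph [ffun i : 'I_n => [ffun j : 'I_n => gap_adj n i j]].
Proof.
apply/andP; split; first by apply/forallP => i; rewrite !ffunE /gap_adj eqxx.
apply/'forall_forallP => i j; rewrite !ffunE /gap_adj; apply/eqP.
by rewrite [(i : nat) == _]eq_sym; congr (_ && _); apply: eq_sym.
Qed.

Definition gap_graph n : graph n := Sub _ (gap_graph_subproof n).

Lemma adj_gap_graph n (i j : 'I_n) : adj (gap_graph n) i j = gap_adj n i j.
Proof. by rewrite /adj SubK !ffunE. Qed.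

Section GapGraph.
Context (N : nat).
Let n := N.*2.
Let m := pair_count n.

Lemma label_low v : (v < m)%N -> (m.*2 < N)%N -> label n m v = v.
Proof. rewrite /n /label /=; clearbody m; lia. Qed.

Lemma label_high v : (v < m)%N -> (m.*2 < N)%N -> label n m (n - v.+1) = v.
Proof. rewrite /n /label /=; clearbody m; lia. Qed.

Lemma label_mid_low v : (m <= v < N)%N -> (m.*2 < N)%N -> label n m v = m.
Proof. rewrite /n /label /=; clearbody m; lia. Qed.

Lemma label_mid_high v : (m <= v < N)%N -> (m.*2 < N)%N ->
  label n m (n - v.+1) = m.+1.
Proof. rewrite /n /label /=; clearbody m; lia. Qed.

Hypothesis mN : (m.*2 < N)%N.

(** Fold the vertices along [v -> n - 1 - v]: the two vertices of a pair share a label, and outside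
    the pairs each fold meets both cliques. *)
Lemma sum_label (V : nmodType) (F : nat -> V) :
  \sum_(v < n) F (label n m v) =
  \sum_(v < m) F v *+ 2 + (F m + F m.+1) *+ (N - m).
Proof.
have mN' : (m <= N)%N by lia.
rewrite -(big_mkord xpredT (fun v => F (label n m v))).
rewrite (@big_cat_nat _ _ _ N) //=; last by rewrite /n; lia.
rewrite [X in _ + X]big_nat_rev /=.
rewrite (_ : \sum_(N <= i < n) _ = \sum_(0 <= i < N) F (label n m (n - i.+1))).
  rewrite -big_split /= (@big_cat_nat _ _ _ m) //=; congr (_ + _).
    rewrite big_mkord; apply: eq_bigr => v _.
    by rewrite label_low ?label_high.
  rewrite (eq_big_nat _ _ (F2 := fun=> F m + F m.+1)) ?sumr_const_nat //.
  by move=> v vN; rewrite label_mid_low ?label_mid_high.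
rewrite -{1}[N]add0n big_addn (_ : n - N = N)%N; last by rewrite /n; lia.
apply: eq_big_nat => v vN; congr (F (label _ _ _)); rewrite /n; lia.
Qed.

(* Membership in a half without cut edges is a function f of the label, and
   counting vertices gives 2 (f 0 + ... + f (m - 1)) + (N - m) (f m + f (m + 1))
   = N: impossible, by parity if f m <> f (m + 1), and by size otherwise. *)
Lemma gap_graph_cut_gt0 (S : {set 'I_n}) : bisection S ->
  (0 < cut_size (gap_graph n) S)%N.
Proof.
move=> /eqP Sn; rewrite card_gt0; apply/negP => /eqP cut0.
have same (i j : 'I_n) : label n m i = label n m j -> (i \in S) = (j \in S).
  wlog ij : i j / (i < j)%N.
    move=> H; have [ij|ji|/val_inj -> //] := ltngtP i j; first exact: H.
    by move=> e; symmetry; apply: H.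
  move=> e; apply/eqP/negPn/negP => Sij.
  have := in_set0 (i, j).
  by rewrite -cut0 !inE /= ij adj_gap_graph /gap_adj neq_ltn ij e eqxx Sij.
pose f l := [exists v : 'I_n, (label n m v == l) && (v \in S)].
have fS (v : 'I_n) : f (label n m v) = (v \in S).
  apply/existsP/idP => [[w /andP[/eqP wv]]|vS]; first by rewrite (same _ _ wv).
  by exists v; rewrite eqxx.
have := @sum_label nat (fun l => nat_of_bool (f l)).
rewrite (eq_bigr (fun v : 'I_n => nat_of_bool (v \in S))); last first.
  by move=> v _; rewrite fS.
rewrite -big_mkcond sum1_card /=.
have natM (a b : nat) : a *+ b = (a * b)%N.
  by rewrite -mulr_natr natn.
rewrite sumrMnl !natM.
have sm : (\sum_(v < m) f v <= m)%N.
  rewrite -[leqRHS]card_ord -sum1_card.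
  by apply: leq_sum => v _; apply: leq_b1.
have arith (s c r : nat) (a b : bool) : c.*2 = n -> m = r.*2.+1 -> (s <= m)%N ->
    c = (s * 2 + (a + b) * (N - m))%N -> False.
  by rewrite /n; clear -mN; case: a; case: b => /=; clearbody m; lia.
exact: (arith _ _ _ _ _ Sn (erefl _) sm).
Qed.

Context {R : realType}.
Let T := 'I_m.

(* Pair v is on the side given by v \in J, and the cliques are on opposite
   sides. *)
Definition gap_sign (v : 'I_n) (J : {set T}) : R :=
  let l := label n m v in
  if insub l is Some i then (-1) ^+ (i \in J) else (-1) ^+ (l != m).

Lemma gap_sign_sqr v J : gap_sign v J ^+ 2 = 1.
Proof. by rewrite /gap_sign; case: insubP => *; rewrite sqrr_sign. Qed.

Lemma degree_le_gap_sign v : degree_le 1 (gap_sign v).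
Proof.
rewrite /gap_sign; case: insubP => [i _ _|_]; last exact: degree_le_cst.
rewrite (_ : (fun J => _) = fun J => 2 * avoid [set i] J + (- 1)).
  apply: degree_le_lin; last exact: degree_le_cst.
  by apply: degree_le_avoid; rewrite cards1.
apply/funext => J; rewrite /avoid sub1set inE.
by case: (i \in J); rewrite /= ?expr0 ?expr1; ring.
Qed.

(** The cliques cancel, and each pair contributes [2 (2 z - 1)]. *)
Lemma sum_gap_sign (J : {set T}) :
  \sum_v gap_sign v J = 4 * (#|~: J|%:R - #|T|%:R / 2).
Proof.
rewrite /gap_sign.
rewrite (sum_label _ (fun l => if insub l is Some i then (-1) ^+ (i \in J : bool)
   else (-1) ^+ (l != m))).
(* The labels [m] and [m + 1] are outside ['I_m] and get the fixed signs 1 and -1. *)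
rewrite !insubN ?ltnn -?leqNgt // eqxx neq_ltn ltnSn orbT /=.
rewrite expr0 expr1 subrr mul0rn addr0 sumrMnl.
rewrite (eq_bigr (fun i : T => (i \in ~: J)%:R *+ 2 - 1)); last first.
  by move=> i _; rewrite valK inE; case: (i \in J); rewrite /= ?expr0 ?expr1; ring.
rewrite sumrB sumrMnl -natr_sum -big_mkcond sum1_card sumr_const /T card_ord.
by rewrite -mulr_natl; field.
Qed.

Definition gap_pE : mpoly n R -> R := slice_pE (#|T|%:R / 2) gap_sign.

(** Adjacent vertices share a label, hence a sign, so the cut polynomial vanishes at every point of
    the cube. *)
Lemma gap_pE_cut : gap_pE (cut_poly R (gap_graph n)) = 0.
Proof.
rewrite /gap_pE /slice_pE (eq_slice_expect _ _ (fun=> 0 * 0)).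
  by rewrite slice_expectZ mul0r.
move=> J; rewrite mul0r /cut_poly mevalZ raddf_sum big1 ?mulr0 //= => p.
rewrite inE adj_gap_graph => /andP[_ /andP[_ /eqP e]].
rewrite expr2 mevalM mevalB !mevalXU.
by rewrite /gap_sign e subrr mulr0.
Qed.

(** For [k = m / 2], the bound [4 t <= m] says [2 t <= k], which gives all the bounds of
    [pseudoexpectation_slice]. *)
Lemma gap_pE_sos t : (1 < m)%N -> (t * 4 <= m)%N -> sos_solution t.*2 gap_pE.
Proof.
move=> m1 tm; have tm' : t%:R * 4 <= m%:R :> R by rewrite -natrM ler_nat.
split.
  apply: pseudoexpectation_slice; rewrite ?card_ord.
  - exact: gap_sign_sqr.
  - exact: degree_le_gap_sign.
  - by lia.
  - by rewrite -muln2 natrM; lra.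
  - have : 0 <= t%:R :> R by []. by lra.
apply: (slice_pE_bisection _ _ _ 4).
- exact: degree_le_gap_sign.
- by rewrite card_ord.
- exact: sum_gap_sign.
Qed.
End GapGraph.

(** * Execution of register programs *)

(** The arbitrary continuation [q] lets fragments be concatenated and used as loop bodies; [T] is
    only an upper bound, so costs can be rounded up. *)
Definition runs (T : nat) (p : seq instr) (s s' : state) : Prop :=
  exists2 t, (t <= T)%N & forall q, iter t step (p ++ q, s) = (q, s').

Lemma runs_leq T T' p s s' : (T <= T')%N -> runs T p s s' -> runs T' p s s'.
Proof. by move=> TT' [t tT h]; exists t => //; apply: leq_trans TT'. Qed.

Lemma runs_cat T1 T2 p1 p2 s1 s2 s3 :
  runs T1 p1 s1 s2 -> runs T2 p2 s2 s3 -> runs (T1 + T2) (p1 ++ p2) s1 s3.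
Proof.
move=> [t1 tT1 h1] [t2 tT2 h2]; exists (t1 + t2)%N; first exact: leq_add.
by move=> q; rewrite addnC iterD -catA h1 h2.
Qed.

Lemma runs_while_end x b s : memory s x = 0%N -> runs 1 [:: IWhile x b] s s.
Proof. by move=> h; exists 1%N => // q; rewrite /= h. Qed.

Lemma runs_while T T' x b s1 s2 s3 : memory s1 x <> 0%N ->
  runs T b s1 s2 -> runs T' [:: IWhile x b] s2 s3 ->
  runs (1 + (T + T')) [:: IWhile x b] s1 s3.
Proof.
move=> /eqP/negPf h [t tT hb] [t' tT' hw]; exists (1 + (t + t'))%N.
  by rewrite leq_add2l leq_add.
move=> q; rewrite addnC iterD /= h addnC iterD hb; exact: hw.
Qed.

(** A halted configuration is fixed by [step], so the machine may idle until time [t]. *)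
Lemma runs_prints T t P (n : nat) (r : seq bool) s :
  runs T P (State (fun y => if y == 0 then n else 0)%N r [::]) s ->
  (T <= t)%N -> forall w, prints P n r t w = (output s == w).
Proof.
move=> [t' t'T h] Tt w; rewrite /prints /run.
rewrite -(subnK (leq_trans t'T Tt)) iterD -{1 2}[P]cats0 h.
by have -> k : iter k step ([::], s) = ([::], s) by elim: k => //= k ->.
Qed.

(** Memory as a finite list, so that straight-line code can be run symbolically by reduction. *)
Definition regs (l : seq nat) (r : seq bool) (o : seq nat) : state :=
  State (nth 0%N l) r o.

Definition straight (i : instr) : bool :=
  match i with
  | IConst _ _ | IAdd _ _ _ | ISub _ _ _ | IPrint _ => true
  | _ => false
  end.

Definition exec (c : seq nat * seq nat) (i : instr) : seq nat * seq nat :=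
  let: (l, o) := c in
  match i with
  | IConst x k => (set_nth 0 l x k, o)%N
  | IAdd x y z => (set_nth 0 l x (nth 0 l y + nth 0 l z), o)%N
  | ISub x y z => (set_nth 0 l x (nth 0 l y - nth 0 l z), o)%N
  | IPrint x => (l, rcons o (nth 0%N l x))
  | _ => c
  end.

Lemma write_regs l r o x k : write (regs l r o) x k = regs (set_nth 0 l x k)%N r o.
Proof. by congr State; apply/funext => y; rewrite nth_set_nth. Qed.

Lemma runs_straight p l r o : all straight p ->
  runs (size p) p (regs l r o)
       (regs (foldl exec (l, o) p).1 r (foldl exec (l, o) p).2).
Proof.
elim: p l o => [|i p IH] l o; first by exists 0%N.
case/andP=> si sp; pose c := exec (l, o) i.
have [t tp h] := IH c.1 c.2 sp; exists t.+1 => // q; rewrite iterSr.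
rewrite (_ : step _ = (p ++ q, regs c.1 r c.2)); last first.
  by rewrite /c; case: i si {c h} => //= *; rewrite ?write_regs.
by rewrite h -surjective_pairing.
Qed.

(** * The sampling program *)

(* Registers: 0 is n, 1 is m, 2 and 3 count down the remaining rows and columns,
   4 and 5 are the row and the column, 6 is 1, 7 is 8 and 8 is 0. *)
Definition label_code (x y : nat) : seq instr :=
  [:: ISub 11 0 6; ISub 11 11 x; ISub 11 x 11; ISub 11 x 11;
      IAdd 12 x x; ISub 12 0 12; ISub 12 6 12;
      ISub 13 1 11; ISub 13 6 13; IAdd 12 12 13; ISub 12 12 6;
      ISub 13 11 1; ISub 11 11 13; IAdd y 11 12].

Definition entry_code : seq instr :=
  label_code 4 9 ++ label_code 5 10 ++
  [:: ISub 11 9 10; ISub 12 10 9; IAdd 11 11 12; ISub 11 6 11;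
      ISub 12 4 5; ISub 13 5 4; IAdd 12 12 13; ISub 12 6 12;
      ISub 11 11 12; IPrint 11; IAdd 5 5 6; ISub 3 3 6].

Definition row_code : seq instr :=
  [:: IConst 5 0; IAdd 3 0 8] ++ [:: IWhile 3 entry_code] ++
  [:: IAdd 4 4 6; ISub 2 2 6].

(** The first loop performs the division by 8 in [pair_count]: it adds 2 to [m] whenever 8 is
    subtracted from the counter. Register 6 holds the increment 2 until then, and 1 afterwards. *)
Definition gap_program : seq instr :=
  [:: IConst 1 1; IConst 2 12; ISub 2 0 2; IConst 6 2; IConst 7 8] ++
  [:: IWhile 2 [:: IAdd 1 1 6; ISub 2 2 7]] ++
  [:: IConst 6 1; IAdd 2 0 8] ++
  [:: IWhile 2 row_code].

(** An arithmetic form of adjacency: with truncated subtraction, [(x - y) + (y - x)] is the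
    distance, and 1 minus it is the truth value of [x = y]. *)
Definition entry (n m i j : nat) : nat :=
  let a := label n m i in let b := label n m j in
  (1 - ((a - b) + (b - a)) - (1 - ((i - j) + (j - i))))%N.

Lemma entryE n i j : entry n (pair_count n) i j = gap_adj n i j.
Proof.
rewrite /entry /gap_adj; move: (label _ _ i) (label _ _ j) => a b.
have [->|ij] := eqVneq i j; first by rewrite !subnn /=; lia.
have [->|ab] := eqVneq a b; rewrite /=; first by rewrite subnn; lia.
by lia.
Qed.

Lemma runs_entry n m ri rj i j t9 t10 t11 t12 t13 r o :
  exists t9' t10' t11' t12' t13',
  runs 40 entry_code
    (regs [:: n; m; ri; rj; i; j; 1; 8; 0; t9; t10; t11; t12; t13]%N r o)
    (regs [:: n; m; ri; rj - 1; i; j + 1; 1; 8; 0; t9'; t10'; t11'; t12'; t13']%N r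
       (rcons o (entry n m i j))).
Proof.
do 5 eexists.
have := @runs_straight entry_code
  [:: n; m; ri; rj; i; j; 1; 8; 0; t9; t10; t11; t12; t13]%N r o isT.
(* Unfolding only list operations keeps the arithmetic symbolic; the final contents of the scratch
   registers then instantiate the existential variables. *)
lazy beta iota zeta delta [foldl exec set_nth nth size
  entry_code label_code cat fst snd ncons].
rewrite /entry /label; lazy zeta.
by apply: runs_leq.
Qed.

Lemma runs_columns n m ri rj i j t9 t10 t11 t12 t13 r o :
  exists t9' t10' t11' t12' t13',
  runs (41 * rj + 1) [:: IWhile 3 entry_code]
    (regs [:: n; m; ri; rj; i; j; 1; 8; 0; t9; t10; t11; t12; t13]%N r o)
    (regs [:: n; m; ri; 0; i; j + rj; 1; 8; 0; t9'; t10'; t11'; t12'; t13']%N r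
       (o ++ [seq entry n m i k | k <- iota j rj])).
Proof.
elim: rj j t9 t10 t11 t12 t13 o => [|rj IH] j t9 t10 t11 t12 t13 o.
  do 5 eexists; rewrite addn0 cats0; exact: runs_while_end.
have [a9 [a10 [a11 [a12 [a13 h]]]]] :=
  runs_entry n m ri rj.+1 i j t9 t10 t11 t12 t13 r o.
rewrite subn1 addn1 /= in h.
have [? [? [? [? [? h']]]]] :=
  IH j.+1 a9 a10 a11 a12 a13 (rcons o (entry n m i j)).
do 5 eexists; rewrite /= (addnS j) -(addSn j) -cat_rcons.
apply: (runs_leq (1 + (40 + (41 * rj + 1)))); first by lia.
by apply: (runs_while _ _ _ _ _ _ _ _ h h').
Qed.

(** A row costs [41 * n + 1] steps for its columns, two for the initialization, two for the update
    and one for the loop test. *)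
Lemma runs_rows n m ri i rj j t9 t10 t11 t12 t13 r o :
  exists s,
  runs ((41 * n + 6) * ri + 1) [:: IWhile 2 row_code]
    (regs [:: n; m; ri; rj; i; j; 1; 8; 0; t9; t10; t11; t12; t13]%N r o) s /\
  output s = o ++ [seq entry n m k l | k <- iota i ri, l <- iota 0 n].
Proof.
elim: ri i rj j t9 t10 t11 t12 t13 o => [|ri IH] i rj j t9 t10 t11 t12 t13 o.
  eexists; split; first by apply: (runs_leq 1); [lia|exact: runs_while_end].
  by rewrite cats0.
have h1 := @runs_straight [:: IConst 5 0; IAdd 3 0 8]
  [:: n; m; ri.+1; rj; i; j; 1; 8; 0; t9; t10; t11; t12; t13]%N r o isT.
lazy beta iota zeta delta [foldl exec set_nth nth size cat fst snd ncons] in h1.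
rewrite addn0 in h1.
have [a9 [a10 [a11 [a12 [a13 h2]]]]] :=
  runs_columns n m ri.+1 n i 0 t9 t10 t11 t12 t13 r o.
rewrite add0n in h2.
have h3 := runs_straight [:: IAdd 4 4 6; ISub 2 2 6]
  [:: n; m; ri.+1; 0; i; n; 1; 8; 0; a9; a10; a11; a12; a13]%N r
  (o ++ [seq entry n m i k | k <- iota 0 n]) isT.
lazy beta iota zeta delta [foldl exec set_nth nth size cat fst snd ncons] in h3.
rewrite subn1 addn1 /= in h3.
have [s [hs os]] := IH i.+1 0%N n a9 a10 a11 a12 a13
  (o ++ [seq entry n m i k | k <- iota 0 n]).
exists s; split; last by rewrite os -catA.
have h := runs_cat _ _ _ _ _ _ _ h1 (runs_cat _ _ _ _ _ _ _ h2 h3).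
by apply: runs_leq (runs_while _ _ 2 _ _ _ _ _ h hs) => //; lia.
Qed.

(** [(c + 7) %/ 8] is [c / 8] rounded up: the last round may subtract less than 8, by truncation. *)
Lemma runs_pair_count n a c r o :
  runs (3 * c + 1) [:: IWhile 2 [:: IAdd 1 1 6; ISub 2 2 7]]
    (regs [:: n; a; c; 0; 0; 0; 2; 8; 0; 0; 0; 0; 0; 0]%N r o)
    (regs [:: n; a + ((c + 7) %/ 8).*2; 0; 0; 0; 0; 2; 8; 0; 0; 0; 0; 0; 0]%N r o).
Proof.
have [k] := ubnP c; elim: k => // k IH in a c *; rewrite ltnS => ck.
have [->|c0] := eqVneq c 0%N.
  by rewrite addn0; apply: (runs_leq 1); last exact: runs_while_end.
have h1 := runs_straight [:: IAdd 1 1 6; ISub 2 2 7]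
  [:: n; a; c; 0; 0; 0; 2; 8; 0; 0; 0; 0; 0; 0]%N r o isT.
lazy beta iota zeta delta [foldl exec set_nth nth size cat fst snd ncons] in h1.
have := IH (a + 2)%N (c - 8)%N.
rewrite (_ : a + 2 + _ = a + ((c + 7) %/ 8).*2)%N; last by lia.
move=> /(_ _) h2; apply: runs_leq (runs_while _ _ 2 _ _ _ _ _ h1 (h2 _)); try lia.
by move=> /= /eqP; rewrite (negPf c0).
Qed.

Lemma runs_gap_program n r : exists s,
  runs (41 * n ^ 2 + 9 * n + 9) gap_program
    (State (fun y => if y == 0 then n else 0)%N r [::]) s /\
  output s = graph_code (gap_graph n).
Proof.
have -> : State (fun y => if y == 0 then n else 0)%N r [::] =
    regs [:: n; 0; 0; 0; 0; 0; 0; 0; 0; 0; 0; 0; 0; 0]%N r [::].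
  congr State; apply/funext => y.
  by do 14 (case: y => [|y] //); case: y.
have h1 := runs_straight
  [:: IConst 1 1; IConst 2 12; ISub 2 0 2; IConst 6 2; IConst 7 8]
  [:: n; 0; 0; 0; 0; 0; 0; 0; 0; 0; 0; 0; 0; 0]%N r [::] isT.
lazy beta iota zeta delta [foldl exec set_nth nth size cat fst snd ncons] in h1.
have h2 := runs_pair_count n 1 (n - 12) r [::].
rewrite add1n -/(pair_count n) in h2.
have h3 := runs_straight [:: IConst 6 1; IAdd 2 0 8]
  [:: n; pair_count n; 0; 0; 0; 0; 2; 8; 0; 0; 0; 0; 0; 0]%N r [::] isT.
lazy beta iota zeta delta [foldl exec set_nth nth size cat fst snd ncons] in h3.
rewrite addn0 in h3.
have [s [h4 os]] := runs_rows n (pair_count n) n 0 0 0 0 0 0 0 0 r [::].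
exists s; split.
  apply: runs_leq (runs_cat _ _ _ _ _ _ _ h1 (runs_cat _ _ _ _ _ _ _ h2
    (runs_cat _ _ _ _ _ _ _ h3 h4))).
  by rewrite -mulnn; lia.
rewrite os cat0s -val_enum_ord allpairs_mapl allpairs_mapr /graph_code.
apply: eq_allpairs => i j.
by rewrite entryE adj_gap_graph.
Qed.

(** Ensures that graphs other than the printed one get probability 0. *)
Lemma graph_code_inj n : injective (@graph_code n).
Proof.
move=> G G'; pose f (H : graph n) (p : 'I_n * 'I_n) := nat_of_bool (adj H p.1 p.2).
have codeE H : graph_code H = map (f H) [seq (a, b) | a <- enum 'I_n, b <- enum 'I_n].
  by rewrite map_allpairs.
rewrite !codeE => /eq_in_map GG'; apply/val_inj/ffunP => a; apply/ffunP => b.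
have := GG' (a, b); rewrite allpairs_f ?mem_enum // => /(_ isT).
by rewrite /f /adj /=; do 2 case: (fun_of_fin _ b).
Qed.

Lemma gap_graph_samplable (R : realType) :
  efficiently_samplable (fun n G => (G == gap_graph n)%:R : R).
Proof.
exists gap_program, 12%N => n n_even t.
(* For [n >= 2], [n ^ 12 >= 64 * n ^ 2] suffices; [n = 0] is covered by the additive 12, and [n = 1]
   is odd. *)
have time : (41 * n ^ 2 + 9 * n + 9 <= t)%N.
  rewrite /t; case: n n_even {t} => [//|[//|n]] _.
  have : (2 ^ 6 <= n.+2 ^ 10)%N.
    by apply: (@leq_trans (2 ^ 10)); rewrite ?leq_exp2r ?leq_pexp2l.
  rewrite (expnD _ 2 10); move: (n.+2 ^ 10)%N => q; rewrite -mulnn; nia.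
have prints_gap (r : t.-tuple bool) w :
    prints gap_program n r t w = (graph_code (gap_graph n) == w).
  by have [s [hs <-]] := runs_gap_program n r; apply: runs_prints hs time w.
split=> [r|G]; first by exists (gap_graph n); rewrite prints_gap.
have [->|neq] := eqVneq G (gap_graph n).
  rewrite (_ : [set r | _]%SET = setT); last first.
    by apply/setP => r; rewrite !inE prints_gap eqxx.
  rewrite cardsT card_tuple card_bool natrX divff ?expf_neq0 ?pnatr_eq0 //.
rewrite (_ : [set r | _]%SET = set0) ?cards0 ?mul0r //.
apply/setP => r; rewrite !inE prints_gap; apply/negP => /eqP /graph_code_inj.
by move=> e; rewrite e eqxx in neq.
Qed.

(** * Genuine bisections and their evaluations *)

Lemma exists_bisection n : ~~ odd n -> exists S : {set 'I_n}, bisection S.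
Proof.
move=> n_even; exists [set v in take n./2 (enum 'I_n)].
rewrite /bisection cardsE (card_uniqP _); last by rewrite take_uniq ?enum_uniq.
rewrite size_take size_enum_ord; have := odd_double_half n.
by rewrite (negPf n_even); case: ifP; lia.
Qed.

Lemma min_bisection_leq n (G : graph n) (S : {set 'I_n}) :
  bisection S -> (min_bisection G <= cut_size G S)%N.
Proof.
move=> bS; rewrite /min_bisection; have := mem_index_enum S.
elim: (index_enum _) => // S' r IH; rewrite inE big_cons => /predU1P[<-|/IH {}IH].
  by rewrite bS geq_minl.
by case: ifP => // _; rewrite geq_min IH orbT.
Qed.

Lemma min_bisection_attained n (G : graph n) : ~~ odd n ->
  exists2 S : {set 'I_n}, bisection S & min_bisection G = cut_size G S.
Proof.
move=> /exists_bisection[S0 bS0].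
have [S bS minS] := arg_minnP (cut_size G) bS0; exists S => //.
apply/eqP; rewrite eqn_leq min_bisection_leq //=.
apply: (big_ind (fun c => cut_size G S <= c)%N) => //.
  by apply/subset_leq_card/subsetP => p; rewrite inE => /andP[].
by move=> a b; rewrite leq_min => -> ->.
Qed.

Section GenuineBisection.
Context {R : realType} {n : nat} (S : {set 'I_n}).

Definition side (v : 'I_n) : R := if v \in S then 1 else - 1.

Lemma side_sqr v : side v ^+ 2 = 1.
Proof. by rewrite /side; case: ifP => _; rewrite ?sqrrN expr1n. Qed.

Lemma meval_cut_poly (G : graph n) :
  meval side (cut_poly R G) = (cut_size G S)%:R.
Proof.
rewrite /cut_poly mevalZ raddf_sum /= /cut_size -sum1_card natr_sum mulr_sumr.
rewrite [LHS]big_mkcond [RHS]big_mkcond /=; apply: eq_bigr => p _.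
rewrite !inE; case: (_ && _) => //=.
rewrite expr2 mevalM mevalB !mevalXU /side.
by case: (p.1 \in S); case: (p.2 \in S); rewrite /=; field.
Qed.

Lemma meval_bisection_poly : bisection S ->
  meval side (bisection_poly R n) = 0.
Proof.
move=> /eqP Sn; rewrite /bisection_poly raddf_sum /=.
rewrite (eq_bigr (fun v => (v \in S)%:R *+ 2 - 1)); last first.
  by move=> v _; rewrite mevalXU /side; case: ifP => _ /=; ring.
rewrite sumrB sumrMnl -natr_sum -big_mkcond sum1_card sumr_const card_ord.
by rewrite -mulrnA muln2 Sn subrr.
Qed.

End GenuineBisection.

(** * The integrality gap *)

Lemma pair_count_bounds n : (12 <= n)%N ->
  (4 * pair_count n < n)%N /\ (n <= 4 * pair_count n + 8)%N.
Proof. by rewrite /pair_count; lia. Qed.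

Lemma gap_sos_solution (R : realType) k : (20 <= k)%N ->
  exists t (E : mpoly k.*2 R -> R),
    [/\ 16^-1 * Num.sqrt k.*2%:R <= t%:R :> R, sos_solution t E &
        E (cut_poly R (gap_graph k.*2)) = 0].
Proof.
move=> k20; have [|lo hi] := @pair_count_bounds k.*2; first by lia.
exists (pair_count k.*2 %/ 4).*2, (@gap_pE k R); split.
(* The degree [d] is linear in [n]: writing [m] for the pair count,
   [16 d >= 8 m - 24 >= 2 n - 40 >= n] as [n >= 40], and [n >= sqrt n]. *)
- have s1 : 1 <= Num.sqrt k.*2%:R :> R.
    by rewrite -[leLHS]sqrtr1 ler_wsqrtr // ler1n; lia.
  have s2 := sqr_sqrtr (ler0n R k.*2).
  have : k.*2%:R <= 16%:R * (pair_count k.*2 %/ 4).*2%:R :> R.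
    by rewrite -natrM ler_nat; lia.
  by nra.
- by apply: gap_pE_sos; lia.
- by apply: gap_pE_cut; lia.
Qed.

Lemma gap_graph_min_bisection_gt0 k : (20 <= k)%N ->
  (0 < min_bisection (gap_graph k.*2))%N.
Proof.
move=> k20; have [|lo hi] := @pair_count_bounds k.*2; first by lia.
have [S bS ->] := @min_bisection_attained _ (gap_graph k.*2) (negbT (odd_double k)).
by apply: gap_graph_cut_gt0 bS; lia.
Qed.

(* Imported only here, as classical_sets shadows the lemmas of finset. *)
From mathcomp Require Import classical_sets ereal topology normedtype sequences.
Import numFieldNormedType.Exports.
Local Open Scope classical_set_scope.

Lemma gap_value_exact (R : realType) (eps : R) k : 0 < eps -> eps <= 3 / 4 ->
  (20 <= k)%N ->
  let G := gap_graph k.*2 in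
  exists (d : nat) (E : mpoly k.*2 R -> R),
    [/\ 16^-1 * Num.sqrt k.*2%:R <= d%:R :> R, pseudoexpectation d E,
        E (cut_poly R G) = (3 / 4 - eps) * (min_bisection G)%:R &
        pseudovariance_zero E (bisection_poly R k.*2) 0].
Proof.
move=> eps0 eps1 k20 G.
have [d [E0 [dk [pE0 [E01 E02]] Ecut]]] := @gap_sos_solution R k k20.
have [S bS minS] := @min_bisection_attained _ G (negbT (odd_double k)).
exists d, (fun p => (1 - (3 / 4 - eps)) * E0 p + (3 / 4 - eps) * meval (side S) p).
split=> //.
- apply: pseudoexpectation_convex => //; first by apply/andP; split; lra.
  by apply: pseudoexpectation_meval; apply: side_sqr.
- by rewrite Ecut mulr0 add0r meval_cut_poly minS.
- split; first by rewrite E01 meval_bisection_poly // !mulr0 addr0.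
  rewrite E02 (expr2 (bisection_poly R _)) mevalM meval_bisection_poly //.
  by rewrite expr0n !mulr0 addr0.
Qed.

(** The relaxation value is at most 0 and the optimum is positive, so every nonnegative factor
    fails. *)
Lemma gap_graph_not_approximated (R : realType) (alpha : R) k d : 0 <= alpha ->
  (20 <= k)%N -> d%:R <= 16^-1 * Num.sqrt k.*2%:R :> R ->
  ~ sos_approximates k.*2 d alpha.
Proof.
move=> alpha0 k20 dk /(_ (gap_graph k.*2)); apply/negP; rewrite -ltNge.
have [d' [E0 [dk' [pE0 var0] Ecut]]] := @gap_sos_solution R k k20.
apply: (@le_lt_trans _ _ 0%E); last first.
  by rewrite lte_fin ltr0n gap_graph_min_bisection_gt0.
apply: mule_ge0_le0; first by rewrite lee_fin.
apply: ereal_inf_lbound; exists E0; last by rewrite Ecut.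
split=> //; apply: pseudoexpectation_leq pE0.
by rewrite -(ler_nat R); apply: le_trans dk'.
Qed.

Theorem theorem11 (R : realType) (eps : R)
    (eps_gt0 : 0 < eps) (eps_le : eps <= 3 / 4) :
  (exists (D : forall n : nat, graph n -> R)
          (norm : forall n : nat, graph n -> R)
          (c : R),
     [/\ forall n : nat, ~~ odd n -> distribution (D n),
         efficiently_samplable D,
         forall (n : nat) (G : graph n), 0 < norm n G,
         0 < c &
         with_high_probability D (fun n G =>
           (exists (d : nat) (E : mpoly n R -> R),
              [/\ c * Num.sqrt n%:R <= d%:R,
                  pseudoexpectation d E,
                  E (cut_poly R G) / norm n G = 3 / 4 - eps &
                  pseudovariance_zero E (bisection_poly R n) 0]) /\
           (forall S : {set 'I_n}, bisection S ->
              1 - eps <= (cut_size G S)%:R / norm n G))])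
  /\
  (forall d : nat -> nat,
     (d n)%:R / Num.sqrt n%:R @[n --> \oo] --> (0 : R) ->
     \forall k \near \oo,
       ~ sos_approximates k.*2 (d k.*2) (4 / 3 - eps)).
Proof.
split; last first.
  move=> d d0.
  (* Eventually [d n] is below [sqrt n / 16], hence below the degree of the gap solution. *)
  have /cvgr_dist_lt/(_ 16^-1) := d0; rewrite invr_gt0 ltr0n => /(_ isT)[N _ HN].
  exists (maxn N 20) => // k /=; rewrite geq_max => /andP[Nk k20].
  apply: gap_graph_not_approximated => //; first by lra.
  have /= := HN k.*2 (leq_trans Nk _); rewrite sub0r normrN.
  have sk : 0 < Num.sqrt k.*2%:R :> R by rewrite sqrtr_gt0 ltr0n; lia.
  rewrite ger0_norm ?divr_ge0 ?sqrtr_ge0 // ltr_pdivrMr // => h.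
  by apply/ltW/h; rewrite -addnn leq_addr.
(* The maximum with 1 keeps the normalization positive on all graphs; on the gap graph it is the
   optimum. *)
exists (fun n G => (G == gap_graph n)%:R),
  (fun n G => (maxn 1 (min_bisection G))%:R), 16^-1.
have sum_point n (P : pred (graph n)) :
    \sum_(G | P G) (G == gap_graph n)%:R = (P (gap_graph n))%:R :> R.
  rewrite big_mkcond (bigD1 (gap_graph n)) //= eqxx big1 => [|G /negPf ->].
    by rewrite addr0; case: (P _).
  by case: (P G).
split.
- move=> n _; split=> [G|]; first exact: ler0n.
  by rewrite (sum_point n xpredT).
- exact: gap_graph_samplable.
- by move=> n G; rewrite ltr0n leq_max.
- by rewrite invr_gt0 ltr0n.
rewrite /with_high_probability; apply: cvg_near_cst.
(* From [k = 20] on the probability is exactly 1. *)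
exists 20 => // k /= k20; rewrite /Pr sum_point.
have min_gt0 := gap_graph_min_bisection_gt0 k k20.
have norm_neq0 : (min_bisection (gap_graph k.*2))%:R != 0 :> R.
  by rewrite pnatr_eq0 -lt0n.
rewrite asboolT //= (maxn_idPr min_gt0); split.
  have [d [E [dk pE Ecut var0]]] := gap_value_exact R eps k eps_gt0 eps_le k20.
  by exists d, E; split=> //; rewrite Ecut mulfK.
move=> S bS; rewrite ler_pdivlMr ?ltr0n //.
have := min_bisection_leq _ (gap_graph k.*2) S bS; rewrite -(ler_nat R).
have : 0 < (min_bisection (gap_graph k.*2))%:R :> R by rewrite ltr0n.
nra.
Qed.
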